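(* Let $n\in\mathbb{N}$, let $\omega=(\omega_1,\dots,\omega_n)\in W_n$ be a weight vector, let $\alpha=(\alpha_1,\dots,\alpha_n)\in(0,1]^n$ be a membership degree vector, and let $\mathcal{A}:\bigcup_{m\in\mathbb{N}}\mathbb{R}^m\to\mathbb{R}$ be an extended aggregation function. Let $\vartheta,\varphi_\alpha:W_n\cup\{\mathbf{0}_n\}\to W_n\cup\{\mathbf{0}_n\}$ be the first and second weight distributions, with associated valuations $v_\vartheta^k,v_{\varphi_\alpha}^k:\mathcal{C}\to\mathbb{R}$ ($k\in\mathbb{N}_0$). Define $\Phi_{\alpha,\omega,\mathcal{A}}:\mathcal{C}\to\operatorname{seq}(\mathbb{R})$ by $$\Phi_{\alpha,\omega,\mathcal{A}}(A)(k)=\begin{cases} v_\vartheta^k(A), & k\in\{0,1,\dots,n-1\},\\ v_{\varphi_\alpha}^{k-(n-1)}(A), & k\in\{n,n+1,\dots,2n-2\},\\ 0,& k\ge 2n-1.\end{cases}$$ Then the $\alpha$-order $\overset{\alpha}{\le}$ on $\mathcal{C}$ is exactly the $\Phi_{\alpha,\omega,\mathcal{A}}$-sequential binary relation; that is, for all $A,B\in\mathcal{C}$, $A\overset{\alpha}{\le}B$ if and only if $\Phi_{\alpha,\omega,\mathcal{A}}(A)\sqsubseteq\Phi_{\alpha,\omega,\mathcal{A}}(B)$.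
   Context: $\mathbb{N}_0=\{0,1,2,\dots\}$. $\operatorname{seq}(\mathbb{R})=\mathbb{R}^{\mathbb{N}_0}$, and for $\mathfrak a=\{a_k\},\mathfrak b=\{b_k\}\in\operatorname{seq}(\mathbb{R})$, $\mathfrak a\sqsubseteq\mathfrak b$ means that either $\mathfrak a=\mathfrak b$, or there is $k_0\in\mathbb{N}_0$ with $a_k=b_k$ for all $k<k_0$ and $a_{k_0}<b_{k_0}$. A fuzzy set on $\mathbb{R}$ is a map $A:\mathbb{R}\to[0,1]$; for $\beta\in(0,1]$ its $\beta$-cut is $A_\beta=\{x:A(x)\ge\beta\}$; its support is the union of these cuts. $\mathcal{C}$ is the family of fuzzy sets $A$ on $\mathbb{R}$ that are normal ($A(x)=1$ for some $x$), have bounded support, and whose cuts $A_\beta$ ($\beta\in(0,1]$) are closed subsets of $\mathbb{R}$ with finitely many connected components. $W_n$ is the set of $\omega\in[0,1]^n$ with $\omega_1+\dots+\omega_n=1$, and $\mathbf{0}_n$ is the zero vector of $\mathbb{R}^n$. The weight distributions $\vartheta$ and $\varphi_\alpha$ are to be taken as given self-maps of $W_n\cup\{\mathbf{0}_n\}$; $\vartheta^k$, $\varphi_\alpha^k$ denote their $k$-fold iterates ($k=0$ being the identity), and $\vartheta^k(\omega)(j)$, $\varphi_\alpha^k(\omega)(j)$ denote $j$-th components. For $A\in\mathcal{C}$ and $j\in\{1,\dots,n\}$, $\mathcal{A}^A_{\alpha_j}\in\mathbb{R}$ denotes the real number assigned by the aggregation function $\mathcal{A}$ to the cut $A_{\alpha_j}$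 (a given real number depending only on $\mathcal{A}$ and $A_{\alpha_j}$). The valuations are $$v_\vartheta^k(A)=\sum_{j=1}^n\vartheta^k(\omega)(j)\,\mathcal{A}^A_{\alpha_j},\qquad v_{\varphi_\alpha}^k(A)=\sum_{j=1}^n\varphi_\alpha^k(\omega)(j)\,\mathcal{A}^A_{\alpha_j}.$$ For $A,B\in\mathcal{C}$ and $\psi\in\{\vartheta,\varphi_\alpha\}$: for $m\in\{0,\dots,n-1\}$, write $A=^{\psi}_m B$ iff $v_\psi^k(A)=v_\psi^k(B)$ for all $k\in\{0,\dots,m\}$; write $A\overset{\psi}{<}B$ iff either $v_\psi^0(A)<v_\psi^0(B)$, or there is $k_0\in\{1,\dots,n-1\}$ such that $A=^{\psi}_m B$ for every $m<k_0$ and $v_\psi^{k_0}(A)<v_\psi^{k_0}(B)$. Then $A\overset{\alpha}{=}B$ iff $A=^{\vartheta}_{n-1}B$ and $A=^{\varphi_\alpha}_{n-1}B$; $A\overset{\alpha}{<}B$ iff $A\overset{\vartheta}{<}B$, or ($A=^{\vartheta}_{n-1}B$ and $A\overset{\varphi_\alpha}{<}B$); and $A\overset{\alpha}{\le}B$ iff $A\overset{\alpha}{=}B$ or $A\overset{\alpha}{<}B$. *)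

(* Defs.v *)
From mathcomp Require Import all_boot all_order all_algebra.
From mathcomp Require Import all_classical all_reals all_analysis.
Set Implicit Arguments.
Unset Strict Implicit.
Unset Printing Implicit Defensive.
Import Order.TTheory GRing.Theory Num.Theory.
Import numFieldNormedType.Exports.
Local Open Scope classical_set_scope.
Local Open Scope ring_scope.

Definition seq_le (R : realType) (a b : nat -> R) : Prop :=
  a = b \/
  exists k0 : nat, (forall k, (k < k0)%N -> a k = b k) /\ a k0 < b k0.

Definition sequential_rel (R : realType) (X : Type) (Phi : X -> nat -> R)
  (x y : X) : Prop := seq_le (Phi x) (Phi y).

Record fuzzy_set (R : realType) := FuzzySet {
  membership :> R -> R;
  membership01 : forall x, 0 <= membership x <= 1 }.

Definition fcut (R : realType) (A : fuzzy_set R) (b : R) : set R :=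
  [set x | b <= A x].

Definition fsupport (R : realType) (A : fuzzy_set R) : set R :=
  \bigcup_(b in [set b : R | 0 < b <= 1]) fcut A b.

Record fuzzyC (R : realType) := FuzzyC {
  fuzzyC_set :> fuzzy_set R;
  fuzzyC_normal : exists x, fuzzyC_set x = 1;
  fuzzyC_bounded : bounded_set (fsupport fuzzyC_set);
  fuzzyC_closed : forall b : R, 0 < b <= 1 -> closed (fcut fuzzyC_set b);
  fuzzyC_components : forall b : R, 0 < b <= 1 ->
    finite_set (connected_component (fcut fuzzyC_set b) @` fcut fuzzyC_set b) }.

(* The arity of [ext_agg_fun A m] is m + 1, so that all arities are positive.
   On the real line the usual boundary conditions of an aggregation function
   (infimum and supremum of the values are those of the domain interval) read
   inf = -oo and sup = +oo. *)
Record ext_agg (R : realType) := ExtAgg {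
  ext_agg_fun :> forall m : nat, 'rV[R]_m.+1 -> R;
  ext_agg_mono : forall m (x y : 'rV[R]_m.+1),
    (forall i, x 0 i <= y 0 i) -> ext_agg_fun x <= ext_agg_fun y;
  ext_agg_inf : forall m,
    ereal_inf (range (fun x : 'rV[R]_m.+1 => (ext_agg_fun x)%:E)) = -oo%E;
  ext_agg_sup : forall m,
    ereal_sup (range (fun x : 'rV[R]_m.+1 => (ext_agg_fun x)%:E)) = +oo%E }.

Definition weights (R : realType) (n : nat) : set 'rV[R]_n :=
  [set w | (forall j, 0 <= w 0 j <= 1) /\ \sum_j w 0 j = 1].
Arguments weights R n _ : clear implicits.

Definition weights0 (R : realType) (n : nat) : set 'rV[R]_n :=
  weights R n `|` [set 0].
Arguments weights0 R n _ : clear implicits.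

(* [cutval Agg S] is the real number that the aggregation function [Agg]
   assigns to a cut [S]; [psi] is one of the two weight distributions. *)
Definition valuation (R : realType) (n : nat)
    (cutval : ext_agg R -> set R -> R) (Agg : ext_agg R)
    (omega alpha : 'rV[R]_n) (psi : 'rV[R]_n -> 'rV[R]_n)
    (k : nat) (A : fuzzyC R) : R :=
  \sum_(j < n) (iter k psi omega) 0 j * cutval Agg (fcut A (alpha 0 j)).

Section Orders.
Variables (R : realType) (n : nat).
Implicit Types (v vtheta vphi : nat -> fuzzyC R -> R) (A B : fuzzyC R).

Definition val_eq v (m : nat) A B : Prop :=
  forall k, (k <= m)%N -> v k A = v k B.

Definition val_lt v A B : Prop :=
  v 0%N A < v 0%N B \/
  exists k0 : nat, [/\ (1 <= k0 <= n.-1)%N,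
    forall m, (m < k0)%N -> val_eq v m A B & v k0 A < v k0 B].

Definition alpha_eq vtheta vphi A B : Prop :=
  val_eq vtheta n.-1 A B /\ val_eq vphi n.-1 A B.

Definition alpha_lt vtheta vphi A B : Prop :=
  val_lt vtheta A B \/ (val_eq vtheta n.-1 A B /\ val_lt vphi A B).

Definition alpha_le vtheta vphi A B : Prop :=
  alpha_eq vtheta vphi A B \/ alpha_lt vtheta vphi A B.

Definition Phi_seq vtheta vphi A (k : nat) : R :=
  if (k <= n.-1)%N then vtheta k A
  else if (k <= 2 * n - 2)%N then vphi (k - n.-1)%N A
  else 0.

End Orders.

(* Main.v *)
(* Both weight distributions are iterated from the same [omega], so the two
   valuations agree at level 0. Hence [Phi_seq] lists the valuations of the first
   distribution at levels 0, ..., n - 1 followed by those of the second one at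
   levels 1, ..., n - 1, the omitted level 0 being settled by the first block;
   comparing the two blocks one after the other is the lexicographic comparison. *)

Require Import Defs.
From mathcomp Require Import all_boot all_order all_algebra.
From mathcomp Require Import zify.
From mathcomp Require Import all_classical all_reals all_analysis.
Import Order.TTheory GRing.Theory Num.Theory.
Import numFieldNormedType.Exports.
Local Open Scope classical_set_scope.
Local Open Scope ring_scope.

Section PhiSeq.
Context {R : realType} {n : nat}.
Implicit Types (v w : nat -> fuzzyC R -> R) (A B : fuzzyC R).

(** The separate clause for level 0 is the case [k = 0], and [val_eq v m] for all [m < k] amounts to
    equality at every level below [k]. *)
Lemma val_ltP v A B :
  val_lt n v A B <->
  exists k, [/\ (k <= n.-1)%N, forall i, (i < k)%N -> v i A = v i B
              & v k A < v k B].
Proof.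
split=> [[v0|[k [/andP[k0 kn] eqv vk]]]|[[|k] [kn eqv vk]]].
- by exists 0%N.
- by exists k; split=> // i /eqv; apply.
- by left.
- by right; exists k.+1; split=> // m mk i im; apply: eqv; apply: leq_ltn_trans mk.
Qed.

Lemma Phi_seq_fst v w A k : (k <= n.-1)%N -> Phi_seq n v w A k = v k A.
Proof. by rewrite /Phi_seq => ->. Qed.

Lemma Phi_seq_snd v w A k : (0 < k <= n.-1)%N ->
  Phi_seq n v w A (n.-1 + k) = w k A.
Proof.
move=> kn; rewrite /Phi_seq ifF; last by lia.
by rewrite ifT ?addKn//; lia.
Qed.

Lemma Phi_seq_tail v w A k : (n.-1 + n.-1 < k)%N -> Phi_seq n v w A k = 0.
Proof. by move=> nk; rewrite /Phi_seq !ifF//; lia. Qed.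
End PhiSeq.

Section SequentialOrder.
Context {R : realType} {n : nat}.
Variables (v w : nat -> fuzzyC R -> R).
Hypothesis vw0 : forall A, v 0%N A = w 0%N A.
Implicit Types A B : fuzzyC R.

(** Level [k] of the second block sits at position [n.-1 + k]. This serves both full equality and a
    first difference inside the second block. *)
Lemma Phi_seq_eq_lt A B k : val_eq v n.-1 A B ->
    (forall i, (i < k)%N -> (i <= n.-1)%N -> w i A = w i B) ->
  forall i, (i < n.-1 + k)%N -> Phi_seq n v w A i = Phi_seq n v w B i.
Proof.
move=> eqv eqw i ik; have [iN|Ni] := leqP i n.-1.
  by rewrite !Phi_seq_fst// eqv.
have [iNN|NNi] := leqP i (n.-1 + n.-1); last by rewrite !Phi_seq_tail.
have -> : i = (n.-1 + (i - n.-1))%N by lia.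
by rewrite !Phi_seq_snd ?eqw//; lia.
Qed.

Lemma alpha_eqE A B :
  alpha_eq n v w A B <-> Phi_seq n v w A = Phi_seq n v w B.
Proof.
split=> [[eqv eqw]|eqPhi].
  (* The cutoff [i.+1] puts position [i] strictly below [n.-1 + i.+1], whatever [n] is. *)
  apply/funext => i; apply: (@Phi_seq_eq_lt _ _ i.+1) => //; last by lia.
  by move=> j _; apply: eqw.
have eqv : val_eq v n.-1 A B.
  by move=> k kn; rewrite -(Phi_seq_fst v w A k kn) eqPhi Phi_seq_fst.
split=> // -[_|k kn]; first by rewrite -!vw0 eqv.
by rewrite -(Phi_seq_snd v w A k.+1 kn) eqPhi Phi_seq_snd.
Qed.

Lemma alpha_ltE A B :
  alpha_lt n v w A B <->
  exists k, (forall i, (i < k)%N -> Phi_seq n v w A i = Phi_seq n v w B i) /\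
            Phi_seq n v w A k < Phi_seq n v w B k.
Proof.
split=> [[/val_ltP[k [kn eqv vk]]|[eqv /val_ltP[k [kn eqw wk]]]]|].
- exists k; split=> [i ik|]; last by rewrite !Phi_seq_fst.
  have iN : (i <= n.-1)%N by lia.
  by rewrite !Phi_seq_fst ?eqv.
(* A strict inequality of [w] at level 0 would transfer to [v], contradicting [eqv]. *)
- have k0 : (0 < k)%N.
    by case: k wk {kn eqw} => //; rewrite -!vw0 eqv// ltxx.
  exists (n.-1 + k)%N; split; last by rewrite !Phi_seq_snd ?k0.
  by apply: Phi_seq_eq_lt => // i ik _; apply: eqw.
move=> [k [eqPhi ltPhi]]; have [kN|Nk] := leqP k n.-1.
  left; apply/val_ltP; exists k; split=> // [i ik|].
    have iN : (i <= n.-1)%N by lia.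
    by rewrite -(Phi_seq_fst v w A i iN) eqPhi// Phi_seq_fst.
  by rewrite -(Phi_seq_fst v w A k kN) -(Phi_seq_fst v w B k kN).
(* Beyond both blocks the two sequences vanish, so no strict inequality occurs there. *)
have [kNN|NNk] := leqP k (n.-1 + n.-1); last first.
  by move: ltPhi; rewrite !Phi_seq_tail// ltxx.
right; split=> [i iN|].
  by rewrite -(Phi_seq_fst v w A i iN) eqPhi ?Phi_seq_fst//; lia.
have kE : k = (n.-1 + (k - n.-1))%N by lia.
have k'N : (0 < k - n.-1 <= n.-1)%N by lia.
apply/val_ltP; exists (k - n.-1)%N; split=> [|[_|i ik]|]; first by lia.
(* Level 0 of [w] is read off position 0, in the first block. *)
- rewrite -!vw0 -(Phi_seq_fst v w A 0%N (leq0n n.-1)).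
  by rewrite eqPhi ?Phi_seq_fst//; lia.
- have iN : (0 < i.+1 <= n.-1)%N by lia.
  by rewrite -(Phi_seq_snd v w A i.+1 iN) eqPhi ?Phi_seq_snd//; lia.
- by move: ltPhi; rewrite {1 2}kE !Phi_seq_snd.
Qed.

Lemma alpha_leE A B :
  alpha_le n v w A B <-> sequential_rel (Phi_seq n v w) A B.
Proof.
rewrite /alpha_le /sequential_rel /seq_le.
by split=> -[/alpha_eqE|/alpha_ltE]; [left|right|left|right].
Qed.
End SequentialOrder.

Theorem theorem4p1 (R : realType) (n : nat) (n_gt0 : (0 < n)%N)
  (omega : 'rV[R]_n) (omegaW : weights R n omega)
  (alpha : 'rV[R]_n) (alpha01 : forall j, 0 < alpha 0 j <= 1)
  (Agg : ext_agg R) (cutval : ext_agg R -> set R -> R)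
  (theta phi_alpha : 'rV[R]_n -> 'rV[R]_n)
  (thetaW : set_fun (weights0 R n) (weights0 R n) theta)
  (phiW : set_fun (weights0 R n) (weights0 R n) phi_alpha) :
  let vtheta := valuation cutval Agg omega alpha theta in
  let vphi := valuation cutval Agg omega alpha phi_alpha in
  forall A B : fuzzyC R,
    alpha_le n vtheta vphi A B <->
    sequential_rel (Phi_seq n vtheta vphi) A B.
(* The agreement at level 0 holds by computation, since [iter 0] is the identity. *)
Proof. by move=> vtheta vphi A B; apply: alpha_leE. Qed.
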